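(* Let $1\le k\le d-1$ be integers. If $d-k$ is even, then $$n(k,d)\le \sum_{j=0}^{\frac{d-k-2}{2}}\left(\frac{1}{2^{j+1}}-\frac{1}{2^{d-k-j}}\right)\left|B_{k+2j}^{(d)}\right|+2^{\frac{d+k}{2}}.$$ If $d-k$ is odd, then $$n(k,d)\le \sum_{j=0}^{\frac{d-k-3}{2}}\left(\frac{1}{2^{j+1}}-\frac{1}{2^{d-k-j}}\right)\left|B_{k+2j}^{(d)}\right|+\frac{1}{2^{\frac{d-k+1}{2}}}\left|B_{d-1}^{(d)}\right|+2^{\frac{d+k-1}{2}}.$$
   Context: A standard box in $\mathbb{R}^d$ is a set $K=K_1\times\cdots\times K_d$ where each $K_i\subseteq\mathbb{R}$ is a closed interval. A finite family of $d$-dimensional standard boxes in $\mathbb{R}^d$ is called $k$-neighborly if the dimension of the intersection of any two distinct members is in $\{d-k,d-k+1,\ldots,d-1\}$ (in particular the intersection is nonempty). For positive integers $1\le k\le d$, $n(k,d)$ is the maximum number of members of a $k$-neighborly family of $d$-dimensional standard boxes in $\mathbb{R}^d$. For a nonnegative integer $m\le d-1$, the configuration $B_m^{(d)}\subseteq\{0,1\}^d$ is defined as follows: if $m=2t$, it is the set of binary vectors of length $d$ with at most $t$ coordinates equal to $1$; if $m=2t+1$, it is the Cartesian product of $\{0,1\}$ with the set of binary vectors of length $d-1$ with at most $t$ coordinates equal to $1$. Thus $|B_m^{(d)}|=\sum_{i=0}^{t}\binom{d}{i}$ if $m=2t$, and $|B_m^{(d)}|=2\sum_{i=0}^{t}\binom{d-1}{i}$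 if $m=2t+1$. Empty sums (upper limit smaller than the lower limit) equal $0$. *)

(* Defs.v *)
From HB Require Import structures.
From mathcomp Require Import all_boot all_order all_algebra.
From mathcomp Require Import finmap.
From mathcomp Require Import all_classical all_reals all_analysis.

Set Implicit Arguments.
Unset Strict Implicit.
Unset Printing Implicit Defensive.

Import Order.TTheory GRing.Theory Num.Theory.

Local Open Scope classical_set_scope.
Local Open Scope ring_scope.

Section Boxes.
Variables (R : realType) (d : nat).

(* Taking n = 0 is harmless: the empty sum of coefficients is not 1. *)
Definition affine_hull (S : set 'rV[R]_d) : set 'rV[R]_d :=
  [set y | exists (n : nat) (c : 'I_n -> R) (x : 'I_n -> 'rV[R]_d),
     [/\ forall i, S (x i), \sum_(i < n) c i = 1
       & y = \sum_(i < n) c i *: x i]].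

(* The affine subspace through x0 whose direction is the row space of V. *)
Definition flat (x0 : 'rV[R]_d) (V : 'M[R]_d) : set 'rV[R]_d :=
  [set x | (x - x0 <= V)%MS].

(* The dimension of a set is that of its affine hull; the empty set has no
   dimension, since a flat is nonempty. *)
Definition has_dim (S : set 'rV[R]_d) (m : nat) : Prop :=
  exists (x0 : 'rV[R]_d) (V : 'M[R]_d),
    affine_hull S = flat x0 V /\ \rank V = m.

Definition closed_interval (I : set R) : Prop :=
  exists a b : R, a <= b /\ I = `[a, b]%classic.

Definition standard_box (S : set 'rV[R]_d) : Prop :=
  exists K : 'I_d -> set R,
    (forall i, closed_interval (K i)) /\
    S = [set x | forall i, K i (x 0 i)].

Definition neighborly_boxes (k : nat) (F : {fset set 'rV[R]_d}) : Prop :=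
  (forall A, A \in F -> standard_box A /\ has_dim A d) /\
  (forall A B, A \in F -> B \in F -> A <> B ->
     exists m : nat, (d - k <= m <= d - 1)%N /\ has_dim (A `&` B) m).

End Boxes.

(* n(k, d).  The supremum is taken in \bar R, so that a finite upper bound on
   it bounds every family; the supremum is then attained, the cardinals being
   natural numbers. *)
Definition max_neighborly (R : realType) (k d : nat) : \bar R :=
  ereal_sup [set (#|` F|%:R)%:E | F in @neighborly_boxes R d k].

Lemma max_neighborlyE (R : realType) (k d n : nat) :
  (exists2 F : {fset set 'rV[R]_d}, neighborly_boxes k F & #|` F| = n) ->
  (forall F : {fset set 'rV[R]_d}, neighborly_boxes k F -> (#|` F| <= n)%N) ->
  max_neighborly R k d = (n%:R)%:E.
Proof.
move=> [F hF <-] hmax; apply/eqP; rewrite eq_le; apply/andP; split.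
  by apply: ge_ereal_sup => _ [G hG <-]; rewrite lee_fin ler_nat hmax.
by apply: ereal_sup_ubound; exists F.
Qed.

(* In the odd case, [behead v] drops the free first coordinate. *)
Definition Bconf (d m : nat) : {set d.-tuple bool} :=
  if odd m then [set v : d.-tuple bool | (count id (behead v) <= m./2)%N]%SET
  else [set v : d.-tuple bool | (count id v <= m./2)%N]%SET.

(* Main.v *)
(* The intervals of the family in direction i pairwise meet, so they share a
   point c i, and two boxes meet in a degenerate interval in direction i exactly
   when one ends and the other starts at c i.  Recording at which side each box
   touches c i turns the family into words of {0, 1, *}^d, any two of which
   clash (0 against 1) in between 1 and k coordinates.  Let S_j be the number of
   binary vectors completing some word with at most j stars.  As the sets of
   completions are disjoint, a word with s stars contributes 2^s to S_j for
   j >= s, so the number of words is at most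
   sum_(j < d - k) S_j / 2^(j + 1) + 2^d / 2^(d - k).
   Completions of words with at most j stars are at Hamming distance at most
   k + 2j, so Kleitman's diameter theorem bounds S_j by |B_(k + 2j)|.  Antipodal
   vectors only complete words with at least d - k stars together, so
   S_j + S_(d - k - 1 - j) <= 2^d; pairing these terms gives the negative
   coefficients. *)
Require Import Defs.
From HB Require Import structures.
From mathcomp Require Import all_boot all_order all_algebra.
From mathcomp Require Import finmap.
From mathcomp Require Import all_classical all_reals all_analysis.
From mathcomp Require Import zify ring.

Set Implicit Arguments.
Unset Strict Implicit.
Unset Printing Implicit Defensive.

Import Order.TTheory GRing.Theory Num.Theory.

(** * Kleitman's diameter theorem *)

(** A member moves only when its target is vacant, so two members can merge only if both of them
    move. *)
Definition compress (T : finType) (f : T -> T) (F : {set T}) : {set T} :=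
  [set (if f A \in F then A else f A) | A in F]%SET.

Lemma card_compress (T : finType) (f : T -> T) (F : {set T}) :
  {in [pred A | (A \in F) && (f A \notin F)] &, injective f} ->
  #|compress f F| = #|F|.
Proof.
move=> inj_f; apply: card_in_imset => A B AF BF /=.
case: (boolP (f A \in F)) => fA; case: (boolP (f B \in F)) => fB //.
- by move=> eAB; rewrite -eAB AF in fB.
- by move=> eAB; rewrite eAB BF in fA.
- by apply: inj_f; rewrite inE ?AF ?BF.
Qed.

(** A compression that moves some member strictly lowers the total weight of the family, so
    iterating must end at a family that no [f i] moves. *)
Lemma compress_stable (T I : finType) (f : I -> T -> T) (w : T -> nat)
    (prop : {set T} -> Prop) :
  (forall i A, f i A = A \/ (w (f i A) < w A)%N) ->
  (forall i F, prop F ->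
     {in [pred A | (A \in F) && (f i A \notin F)] &, injective (f i)}) ->
  (forall i F, prop F -> prop (compress (f i) F)) ->
  forall F, prop F ->
  exists G : {set T},
    [/\ prop G, #|G| = #|F| & forall i A, A \in G -> f i A \in G].
Proof.
move=> w_dec inj_f prop_f F.
have [m] := ubnP (\sum_(A in F) w A)%N; elim: m F => // m IHm F ltFm propF.
have [/forallP stF | ] := boolP [forall i, [forall (A | A \in F), f i A \in F]].
  by exists F; split=> // i; apply/forall_inP.
rewrite negb_forall => /existsP[i]; rewrite negb_forall => /existsP[A].
rewrite negb_imply => /andP[AF fAF].
have ltw : (\sum_(B in compress (f i) F) w B < \sum_(B in F) w B)%N.
  (* Injectivity of the compression on [F] is read off from the equality of cardinals. *)
  rewrite big_imset /=; last first.
    by apply/imset_injP; rewrite (card_compress (inj_f i F propF)).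
  rewrite (bigD1 A) //= [ltnRHS](bigD1 A) //= (negbTE fAF) -addSn.
  apply: leq_add.
    by case: (w_dec i A) => // fA; rewrite fA AF in fAF.
  apply: leq_sum => B _; case: ifP => // _.
  by case: (w_dec i B) => [->|/ltnW].
have [|G [propG cardG stG]] := IHm _ _ (prop_f i F propF).
  exact: leq_trans ltw ltFm.
by exists G; split=> //; rewrite cardG (card_compress (inj_f i F propF)).
Qed.

Section SetDistance.
Variable T : finType.
Implicit Types A B : {set T}.

Definition symdiff A B := (A :\: B) :|: (B :\: A).

Lemma symdiffC A B : symdiff A B = symdiff B A.
Proof. by rewrite /symdiff finset.setUC. Qed.

(** The delicate pair has [A] moved and [B] kept because [B :\ i] is present. If [i] is in both, [A]
    and [B :\ i] have the same symmetric difference as [A :\ i] and [B]; otherwise deleting [i] from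
    [A] only shrinks it. *)
Lemma down_compress (n : nat) (i : T) (F : {set {set T}}) :
  {in F &, forall A B, #|symdiff A B| <= n}%N ->
  {in compress (fun A => A :\ i) F &, forall A B, #|symdiff A B| <= n}%N.
Proof.
move=> diamF.
have mixed A B : A \in F -> B \in F -> A :\ i \notin F -> B :\ i \in F ->
    (#|symdiff (A :\ i) B| <= n)%N.
  move=> AF BF fA fB.
  have iA : i \in A.
    apply: contraR fA => iA; rewrite (_ : A :\ i = A) //.
    by apply/finset.setP=> z; rewrite !inE; case: eqVneq => // ->;
       rewrite (negbTE iA).
  have [iB|iB] := boolP (i \in B).
    rewrite [symdiff _ _](_ : _ = symdiff A (B :\ i)); first exact: diamF.
    apply/finset.setP=> z; rewrite !inE; case: eqVneq => [->|_] //=.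
    by rewrite iA iB.
  apply: leq_trans (diamF _ _ AF BF); apply: subset_leq_card.
  apply/fintype.subsetP=> z; rewrite !inE; case: eqVneq => [->|_] //=.
  by rewrite (negbTE iB).
move=> _ _ /imsetP[A AF ->] /imsetP[B BF ->].
case: ifP => fA; case: ifP => fB.
- exact: diamF.
- by rewrite symdiffC; apply: mixed => //; rewrite fB.
- by apply: mixed => //; rewrite fA.
- apply: leq_trans (diamF _ _ AF BF); apply: subset_leq_card.
  by apply/fintype.subsetP=> z; rewrite !inE; case: eqVneq.
Qed.

(** The shift of extremal set theory, with [i] taking the place of [x]. *)
Definition swap_down (x i : T) (A : {set T}) :=
  if (x \in A) && (i \notin A) then i |: (A :\ x) else A.

Lemma swap_compress (n : nat) (x i : T) (F : {set {set T}}) :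
  {in F &, forall A B, #|A :|: B| <= n}%N ->
  {in compress (swap_down x i) F &, forall A B, #|A :|: B| <= n}%N.
Proof.
move=> diamF.
have mixed A B : A \in F -> B \in F -> swap_down x i A \notin F ->
    swap_down x i B \in F -> (#|swap_down x i A :|: B| <= n)%N.
  move=> AF BF; rewrite {1 3}/swap_down; case: ifP => [|_ /negP//].
  move=> /andP[xA iA] _ fB.
  have xi : x != i by apply: contraNneq iA => <-.
  (* If [i] is in [B], the union does not grow; if only [x] is, compare [A] with the shift of [B];
     if neither is, the union exchanges [x] for [i] and keeps its size. *)
  have [iB|iB] := boolP (i \in B).
    apply: leq_trans (diamF _ _ AF BF); apply: subset_leq_card.
    apply/fintype.subsetP=> z; rewrite !inE; case: (eqVneq z i) => [->|_] /=.
      by rewrite iB orbT.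
    by case: eqVneq => [->|_] //=; rewrite xA.
  have [xB|xB] := boolP (x \in B).
    move: fB; rewrite /swap_down xB iB /= => fB.
    apply: leq_trans (diamF _ _ AF fB); apply: subset_leq_card.
    apply/fintype.subsetP=> z; rewrite !inE; case: (eqVneq z i) => [->|_] /=.
      by rewrite orbT.
    by case: eqVneq => [->|_] //=; rewrite xA.
  rewrite (_ : _ :|: B = i |: ((A :|: B) :\ x)).
    rewrite cardsU1 !inE (negbTE iA) (negbTE iB) andbF /=.
    by have := diamF _ _ AF BF; rewrite (cardsD1 x) !inE xA.
  apply/finset.setP=> z; rewrite !inE; case: (eqVneq z i) => [->|_] //=.
  by case: eqVneq => [->|_] //=; rewrite (negbTE xB).
move=> _ _ /imsetP[A AF ->] /imsetP[B BF ->].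
case: ifP => fA; case: ifP => fB.
- exact: diamF.
- by rewrite finset.setUC; apply: mixed => //; rewrite fB.
- by apply: mixed => //; rewrite fA.
- move: fA fB; rewrite /swap_down.
  case: ifP => [/andP[xA iA] _|_]; last by rewrite AF.
  case: ifP => [/andP[xB iB] _|_]; last by rewrite BF.
  rewrite (_ : _ :|: _ = i |: ((A :|: B) :\ x)).
    rewrite cardsU1 !inE (negbTE iA) (negbTE iB) andbF /=.
    by have := diamF _ _ AF BF; rewrite (cardsD1 x) !inE xA.
  apply/finset.setP=> z; rewrite !inE; case: (eqVneq z i) => [->|_] //=.
  by case: eqVneq.
Qed.

Lemma swap_down_inj (x i : T) (F : {set {set T}}) :
  {in [pred A | (A \in F) && (swap_down x i A \notin F)] &,
    injective (swap_down x i)}.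
Proof.
move=> A B; rewrite !inE => /andP[AF]; rewrite /swap_down.
case: ifP => [/andP[xA iA] _|_]; last by rewrite AF.
move=> /andP[BF]; case: ifP => [/andP[xB iB] _|_]; last by rewrite BF.
move=> eAB; apply/finset.setP=> z; have /finset.setP/(_ z) := eAB; rewrite !inE.
case: (eqVneq z i) => [-> _|_] /=; first by rewrite (negbTE iA) (negbTE iB).
by case: eqVneq => [->|] //=; rewrite xA xB.
Qed.

End SetDistance.

(** * Sizes of Hamming balls *)

Definition ball_card (d t : nat) := (\sum_(i < t.+1) 'C(d, i))%N.

(** The size of the configuration B_m, as [card_Bconf] shows. *)
Definition kleitman_bound (d m : nat) :=
  if odd m then (2 * ball_card d.-1 m./2)%N else ball_card d m./2.

Lemma ball_cardS (d t : nat) :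
  ball_card d.+1 t.+1 = (ball_card d t.+1 + ball_card d t)%N.
Proof.
rewrite /ball_card big_ord_recl [in RHS]big_ord_recl !bin0 -addnA; congr addn.
rewrite -big_split /=; apply: eq_bigr => i _.
by rewrite /bump /= add1n binS.
Qed.

Lemma ball_card0 (d : nat) : ball_card d 0 = 1%N.
Proof. by rewrite /ball_card big_ord_recl big_ord0 bin0. Qed.

(** The symmetry of the binomial coefficients exchanges the lower and upper halves of row
    [2t + 1]. *)
Lemma ball_card_half (t : nat) : (2 * ball_card t.*2.+1 t = 2 ^ t.*2.+1)%N.
Proof.
have := Pascal 1 1 t.*2.+1; rewrite addn1 => ->.
under eq_bigr do rewrite !exp1n !muln1.
rewrite -(big_mkord xpredT (fun i => 'C(t.*2.+1, i))).
rewrite (@big_cat_nat _ _ _ t.+1) //=; last by lia.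
rewrite mul2n -addnn {1}/ball_card big_mkord; congr addn.
rewrite big_nat_rev /= -[t.+1]add0n big_addn big_mkord add0n /ball_card.
have -> : (t.*2.+2 - t.+1 = t.+1)%N by lia.
apply: eq_bigr => i _.
have lei := ltn_ord i.
rewrite -bin_sub; last by lia.
by congr 'C(_, _); lia.
Qed.

(** For [d = 2t] and [d = 2t + 1] alike, the ball involved lives in dimension [2t + 1], where it
    fills half of the cube. *)
Lemma kleitman_bound_pred (d : nat) : (2 * kleitman_bound d.+1 d = 2 ^ d.+1)%N.
Proof.
rewrite /kleitman_bound /=; have := odd_double_half d.
case: odd => /= eqd; set t := d./2 in eqd *.
  by rewrite -eqd add1n ball_card_half -expnS.
by rewrite -eqd add0n ball_card_half.
Qed.

(** Pascal's rule; [0 < d] keeps the predecessor in the odd case from truncating. *)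
Lemma kleitman_boundS (d m : nat) : (0 < d)%N ->
  kleitman_bound d.+1 m.+2 = (kleitman_bound d m.+2 + kleitman_bound d m)%N.
Proof.
case: d => // d _; rewrite /kleitman_bound /= negbK.
by case: odd; rewrite !ball_cardS ?mulnDr.
Qed.

(** Complementation in [X] maps [G] injectively onto a family of subsets of [X] disjoint from
    [F]. *)
Lemma antipodal_bound (T : finType) (X : {set T}) (F G : {set {set T}}) :
  F \subset powerset X -> G \subset powerset X ->
  (forall A, A \in F -> X :\: A \notin G) -> (#|F| + #|G| <= 2 ^ #|X|)%N.
Proof.
move=> FX /fintype.subsetP GX antiFG.
have complK (A : {set T}) : A \subset X -> X :\: (X :\: A) = A.
  move=> /fintype.subsetP AX; apply/finset.setP=> z; rewrite !inE.
  by have := AX z; case: (z \in A) => [->|] //; case: (z \in X).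
have compl_inj : {in G &, injective (fun A => X :\: A)}.
  move=> A B /GX; rewrite powersetE => AX /GX; rewrite powersetE => BX eAB.
  by rewrite -(complK A AX) eAB complK.
rewrite -(card_in_imset compl_inj) -cardsUI.
rewrite [X in (_ + #|pred_of_set X|)%N](_ : _ = finset.set0).
  rewrite cards0 addn0 -card_powerset subset_leq_card //.
  rewrite finset.subUset FX; apply/fintype.subsetP=> _ /imsetP[A _ ->].
  by rewrite powersetE finset.subsetDl.
apply/finset.setP=> A; rewrite !inE.
apply/negP=> /andP[/antiFG AG /imsetP[B BG eA]].
by rewrite eA complK ?BG in AG; have := GX B BG; rewrite ?powersetE.
Qed.

(* For m = d no set of F can have its complement in F.  For m < d, once F is
   stable under replacing x by any smaller element, two members containing x
   miss a common element i, and swapping x for i in one of them shows that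
   deleting x from both leaves a union of size at most m - 2. *)
Lemma katona (T : finType) (d m : nat) (X : {set T}) (F : {set {set T}}) :
  #|X| = d.+1 -> (m <= d)%N -> F \subset powerset X ->
  {in F &, forall A B, #|A :|: B| <= m}%N ->
  (#|F| <= kleitman_bound d.+1 m)%N.
Proof.
have diagonal (e : nat) (Y : {set T}) (G : {set {set T}}) :
    #|Y| = e.+1 -> G \subset powerset Y ->
    {in G &, forall A B, #|A :|: B| <= e}%N ->
    (#|G| <= kleitman_bound e.+1 e)%N.
  move=> cardY GY unionG.
  rewrite -(leq_pmul2l (m := 2)) // kleitman_bound_pred mul2n -addnn -cardY.
  apply: antipodal_bound => // A AG; apply/negP => cAG.
  have := unionG _ _ AG cAG.
  rewrite leqNgt (_ : A :|: (Y :\: A) = Y) ?cardY ?ltnSn //.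
  have /fintype.subsetP/(_ _ AG) := GY.
  rewrite powersetE => /finset.setIidPr AY.
  by rewrite -{1}AY finset.setID.
elim: d m X F => [|d IHd] m X F cardX lemd FX unionF.
  by move: lemd; rewrite leqn0 => /eqP m0; subst m; apply: diagonal FX unionF.
have [eq_md|ne_md] := eqVneq m d.+1.
  by subst m; apply: diagonal FX unionF.
have {ne_md}lemd : (m <= d)%N by lia.
have /card_gt0P[x xX] : (0 < #|X|)%N by rewrite cardX.
pose prop (G : {set {set T}}) := G \subset powerset X /\
  {in G &, forall A B, #|A :|: B| <= m}%N.
(* The total weight counts the members containing [x]; every shift that moves a member removes [x]
   from it. *)
have [i A|i G _|i G [GX unionG]||G [[GX unionG] <- stG]] :=
  @compress_stable _ {i : T | i \in X} (fun i => swap_down x (val i))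
  (fun A => x \in A : nat) prop _ _ _ F.
- rewrite /swap_down; case: ifP => [/andP[xA iA]|_]; [right|by left].
  rewrite !inE eqxx xA orbF; case: eqVneq => // eqxi.
  by rewrite -eqxi xA in iA.
- exact: swap_down_inj.
- split; last exact: swap_compress.
  apply/fintype.subsetP=> _ /imsetP[A AG ->].
  have /fintype.subsetP/(_ _ AG) := GX; rewrite !powersetE => AX.
  case: ifP => // _; rewrite /swap_down; case: ifP => // _.
  rewrite finset.subUset finset.sub1set (valP i) /=.
  exact: fintype.subset_trans (finset.subsetDl _ _) AX.
- by [].
pose G0 := [set A in G | x \notin A]%SET.
pose G1 := [set A in G | x \in A]%SET.
pose G1' := [set A :\ x | A in G1]%SET.
have cardG : #|G| = (#|G0| + #|G1'|)%N.
  rewrite card_in_imset => [|A B]; last first.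
    rewrite !inE => /andP[_ xA] /andP[_ xB] eAB.
    by rewrite -(finset.setD1K xA) eAB finset.setD1K.
  rewrite -(cardsID [set A : {set T} | x \in A]%SET) addnC.
  congr addn; apply: eq_card => A.
    by rewrite !inE andbC.
  by rewrite !inE.
have G0X : G0 \subset powerset (X :\ x).
  apply/fintype.subsetP=> A; rewrite powersetE inE => /andP[AG xA].
  have /fintype.subsetP/(_ _ AG) := GX; rewrite powersetE => AX.
  by rewrite subsetD1 AX.
have G1X : G1' \subset powerset (X :\ x).
  apply/fintype.subsetP=> _ /imsetP[A + ->].
  rewrite powersetE inE => /andP[AG xA].
  have /fintype.subsetP/(_ _ AG) := GX; rewrite powersetE => AX.
  exact: finset.setSD.
have cardXx : #|X :\ x| = d.+1 by have := cardsD1 x X; rewrite xX cardX => -[].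
have union0 : {in G0 &, forall A B, #|A :|: B| <= m}%N.
  by move=> A B; rewrite !inE => /andP[AG _] /andP[BG _]; apply: unionG.
have union1 : {in G1' &, forall A B, #|A :|: B|.+2 <= m}%N.
  move=> _ _ /imsetP[A + ->] /imsetP[B + ->].
  rewrite !inE => /andP[AG xA] /andP[BG xB].
  have leAB := unionG _ _ AG BG.
  have /subsetPn[i iX] : ~~ (X \subset A :|: B).
    by apply/negP => /subset_leq_card; rewrite cardX; lia.
  rewrite !inE negb_or => /andP[iA iB].
  have := unionG _ _ (stG (exist _ i iX) A AG) BG.
  rewrite /swap_down /= xA iA /= -finset.setDUl.
  rewrite (_ : (i |: (A :\ x)) :|: B = i |: (A :|: B)); last first.
    by apply/finset.setP=> z; rewrite !inE orbA; case: (eqVneq z x) => [->|];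
      rewrite ?xA ?xB ?orbT.
  rewrite cardsU1 inE (negbTE iA) (negbTE iB) (cardsD1 x (A :|: B)) inE xA.
  by rewrite !add1n.
(* Induction bounds [G0] with [m] and [G1'] with [m - 2], and the two bounds add up by Pascal's
   rule. For [m <= 1] the family [G1'] is empty, since [union1] would give [2 <= m]. *)
rewrite cardG; have := IHd m _ _ cardXx lemd G0X union0.
case: m => [|[|m]] in lemd unionF prop GX unionG union0 union1 *.
- rewrite (_ : G1' = finset.set0) ?cards0 ?addn0; last first.
    apply/finset.setP=> A; rewrite !inE; apply/negP => A1.
    by have := union1 A A A1 A1.
  by rewrite /kleitman_bound /= !ball_card0.
- rewrite (_ : G1' = finset.set0) ?cards0 ?addn0; last first.
    apply/finset.setP=> A; rewrite !inE; apply/negP => A1.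
    by have := union1 A A A1 A1.
  by rewrite /kleitman_bound /= !ball_card0.
- move=> le0; rewrite kleitman_boundS // leq_add //.
  by apply: (IHd _ (X :\ x)) => //; lia.
Qed.

(** Deleting elements makes the family closed under subsets. It then contains [B :\: A] along with
    [B], and the symmetric difference of [A] and [B :\: A] is the union of [A] and [B], so [katona]
    applies. *)
Lemma kleitman (T : finType) (m : nat) (F : {set {set T}}) :
  (m < #|T|)%N -> {in F &, forall A B, #|symdiff A B| <= m}%N ->
  (#|F| <= kleitman_bound #|T| m)%N.
Proof.
move=> ltmT diamF.
pose prop (G : {set {set T}}) := {in G &, forall A B, #|symdiff A B| <= m}%N.
have [i A|i G _|i G||G [diamG <- stG]] :=
  @compress_stable _ T (fun i A => A :\ i) (fun A => #|A|) prop _ _ _ F.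
- have [iA|iA] := boolP (i \in A); first by right; rewrite (cardsD1 i A) iA.
  left; apply/finset.setP=> z; rewrite !inE.
  by case: eqVneq => // ->; rewrite (negbTE iA).
- have mem (A : {set T}) : (A \in G) && (A :\ i \notin G) -> i \in A.
    case/andP=> AG; apply: contraR => iA; rewrite (_ : A :\ i = A) //.
    apply/finset.setP=> z; rewrite !inE.
    by case: eqVneq => // ->; rewrite (negbTE iA).
  by move=> A B /mem iA /mem iB eAB;
    rewrite -(finset.setD1K iA) eAB finset.setD1K.
- exact: down_compress.
- by [].
have downG (A C : {set T}) : A \in G -> A :\: C \in G.
  have [n] := ubnP #|C|; elim: n C => // n IHn C ltCn AG.
  have [->|/finset.set0Pn[i iC]] := eqVneq C finset.set0.
    by rewrite finset.setD0.
  have -> : A :\: C = (A :\: (C :\ i)) :\ i.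
    apply/finset.setP=> z; rewrite !inE.
    by case: (eqVneq z i) => [->|_] //=; rewrite iC.
  by apply: stG; apply: IHn => //; rewrite (cardsD1 i) iC in ltCn.
case: #|T| (cardsT T) ltmT => // d cardT; rewrite ltnS => lemd.
apply: (katona cardT lemd); first by rewrite powersetT finset.subsetT.
move=> A B AG BG; have := diamG _ _ AG (downG _ A BG).
rewrite (_ : symdiff A (B :\: A) = A :|: B) //.
by apply/finset.setP=> z; rewrite !inE; case: (z \in A); case: (z \in B).
Qed.

(** * Cardinality of the configurations B_m *)

Lemma card_low_weight (n t : nat) :
  #|[set v : n.-tuple bool | (count id v <= t)%N]%SET| = ball_card n t.
Proof.
pose f (A : {set 'I_n}) : n.-tuple bool := [tuple i \in A | i < n].
have f_inj : injective f.
  move=> A B /(congr1 (fun v => tnth v)) eAB; apply/finset.setP=> i.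
  by have := congr1 (fun g => g i) eAB; rewrite /f !tnth_mktuple.
have -> : [set v : n.-tuple bool | (count id v <= t)%N]%SET =
    (f @: [set A : {set 'I_n} | (#|A| <= t)%N])%SET.
  have cardf (A : {set 'I_n}) : count id (f A) = #|A|.
    rewrite /f /= count_map -size_filter cardE {2}/enum_mem; congr size.
    by rewrite enumT.
  apply/finset.setP=> v; rewrite inE; apply/idP/imsetP => [lev|[A + ->]].
    have ev : f [set i | tnth v i]%SET = v.
      by apply: eq_from_tnth => i; rewrite tnth_mktuple inE.
    by exists [set i | tnth v i]%SET; rewrite ?inE -?cardf ev.
  by rewrite inE cardf.
rewrite card_imset // /ball_card; elim: t => [|t IHt].
  rewrite big_ord_recl big_ord0 -[n in RHS]card_ord -card_draws addn0.
  by apply: eq_card => A; rewrite !inE leqn0.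
rewrite big_ord_recr /= -IHt -[n in 'C(n, _)]card_ord -card_draws -cardsUI.
rewrite [X in (_ + #|pred_of_set X|)%N](_ : _ = finset.set0).
  by rewrite cards0 addn0; apply: eq_card => A; rewrite !inE orbC -leq_eqVlt.
apply/finset.setP=> A; rewrite !inE; apply/negP => /andP[leA /eqP eA].
by rewrite eA ltnn in leA.
Qed.

Lemma card_Bconf (d m : nat) : (0 < d)%N -> #|Bconf d m| = kleitman_bound d m.
Proof.
case: d => // d _; rewrite /Bconf /kleitman_bound /=.
case: odd; last exact: card_low_weight.
rewrite -card_low_weight -card_bool -cardsT -cardsX.
pose f (p : bool * d.-tuple bool) : d.+1.-tuple bool := [tuple of p.1 :: p.2].
rewrite -(card_imset _ (f := f)).
  apply: eq_card => v; apply/idP/imsetP => [|[[b u] + ->]].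
    rewrite inE => lev; exists (thead v, [tuple of behead v]).
      by rewrite !inE.
    by rewrite /f /= -tuple_eta.
  by rewrite !inE.
by move=> [b u] [c v] /(congr1 val) [-> /val_inj ->].
Qed.

(** * Words over {0, 1, *} *)

Section Codes.
Variables (T I : finType) (P N : I -> {set T}) (k : nat).
Hypothesis PN0 : forall i, P i :&: N i = finset.set0.

(* A code (P, N) stands for the word over {0, 1, *} with 1 on P, 0 on N and *
   elsewhere; its cube is the set of its completions. *)
Definition cube i : {set {set T}} :=
  [set A : {set T} | (P i \subset A) && (A \subset ~: N i)]%SET.

Definition stars i : {set T} := ~: (P i :|: N i).

Definition clash i j : {set T} := (P i :&: N j) :|: (N i :&: P j).

Hypothesis clash_gt0 : forall i j, i != j -> (0 < #|clash i j|)%N.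
Hypothesis clash_le : forall i j, i != j -> (#|clash i j| <= k)%N.

Lemma card_cube i : #|cube i| = (2 ^ #|stars i|)%N.
Proof.
have PN z : z \in P i -> z \in N i = false.
  by move=> zP; have /finset.setP/(_ z) := PN0 i; rewrite !inE zP.
rewrite -card_powerset -(card_in_imset (f := fun A => P i :|: A)) => [|A B].
  apply: eq_card => A; rewrite inE; apply/andP/imsetP => [[PA AN]|[B + ->]].
    exists (A :\: P i).
      rewrite powersetE; apply/fintype.subsetP=> z; rewrite !inE negb_or.
      by case/andP=> -> /(fintype.subsetP AN); rewrite inE.
    apply/finset.setP=> z; rewrite !inE; have := fintype.subsetP PA z.
    by case: (z \in P i) => [->|].
  rewrite powersetE => /fintype.subsetP Bstars.
  rewrite finset.subsetUl; split=> //.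
  apply/fintype.subsetP=> z; rewrite !inE => /orP[/PN -> //|/Bstars].
  by rewrite !inE negb_or => /andP[].
rewrite !powersetE => /fintype.subsetP As /fintype.subsetP Bs eAB.
apply/finset.setP=> z; have /finset.setP/(_ z) := eAB; rewrite !inE.
have := (As z, Bs z); rewrite !inE.
case: (z \in P i) => //= -[hA hB] _.
by apply/idP/idP => [/hA|/hB].
Qed.

(** A coordinate where two completions differ is a clash of the words or a star of one of them. *)
Lemma symdiff_cube i j A B : A \in cube i -> B \in cube j ->
  (#|symdiff A B| <= k + #|stars i| + #|stars j|)%N.
Proof.
rewrite !inE => /andP[/fintype.subsetP PA /fintype.subsetP AN].
move=> /andP[/fintype.subsetP PB /fintype.subsetP BN].
have clashk : (#|clash i j| <= k)%N.
  have [<-|/clash_le //] := eqVneq i j.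
  by rewrite /clash [N i :&: P i]finset.setIC PN0 finset.setU0 cards0.
have sub : symdiff A B \subset clash i j :|: stars i :|: stars j.
  apply/fintype.subsetP=> z; rewrite !inE.
  have := (PA z, AN z, PB z, BN z); rewrite !inE.
  case: (z \in A); case: (z \in B); case: (z \in P i); case: (z \in N i);
  case: (z \in P j); case: (z \in N j) => //= -[[[h1 h2] h3] h4];
  by [have := h1 isT | have := h2 isT | have := h3 isT | have := h4 isT].
apply: leq_trans (subset_leq_card sub) _.
apply: leq_trans (leq_card_setU _ _) _; rewrite leq_add2r.
by apply: leq_trans (leq_card_setU _ _) _; rewrite leq_add2r.
Qed.

Lemma cube_disjoint i j : i != j -> [disjoint cube i & cube j].
Proof.
move=> /clash_gt0/card_gt0P[z zij]; rewrite -setI_eq0.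
apply/eqP/finset.setP=> A.
rewrite [RHS]inE; apply/negP; rewrite !inE.
case/andP=> /andP[/fintype.subsetP/(_ z) h1 /fintype.subsetP/(_ z) h2].
case/andP=> /fintype.subsetP/(_ z) h3 /fintype.subsetP/(_ z) h4.
move: zij h1 h2 h3 h4; rewrite !inE => /orP[]/andP[-> ->] h1 h2 h3 h4.
  by move: (h4 (h1 isT)).
by move: (h2 (h3 isT)).
Qed.

(** Its cardinality is the quantity S_t of the counting argument. *)
Definition small_cubes (t : nat) : {set {set T}} :=
  (\bigcup_(i : I) (if #|stars i| <= t then cube i else finset.set0)%N)%SET.

Lemma small_cubesP (t : nat) A :
  reflect (exists2 i, (#|stars i| <= t)%N & A \in cube i) (A \in small_cubes t).
Proof.
apply: (iffP finset.bigcupP) => [[i _]|[i leit iA]].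
  by case: ifP => [leit iA|]; [exists i | rewrite inE].
by exists i => //; rewrite leit.
Qed.

Lemma card_small_cubes (t : nat) :
  #|small_cubes t| = (\sum_(i | #|stars i| <= t) 2 ^ #|stars i|)%N.
Proof.
rewrite -sum1_card partition_disjoint_bigcup /=; last first.
  move=> i j /cube_disjoint; case: ifP => _; case: ifP => _ //;
    by rewrite -!setI_eq0 ?finset.set0I ?finset.setI0.
rewrite [RHS]big_mkcond; apply: eq_bigr => i _; rewrite sum1_card.
by case: ifP => _; rewrite ?card_cube ?cards0.
Qed.

Lemma small_cubes_kleitman (t : nat) : (k + 2 * t < #|T|)%N ->
  (#|small_cubes t| <= kleitman_bound #|T| (k + 2 * t))%N.
Proof.
move=> ltT; apply: kleitman => // A B.
move=> /small_cubesP[i lei iA] /small_cubesP[j lej jB].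
by apply: leq_trans (symdiff_cube iA jB) _; lia.
Qed.

Lemma small_cubes_antipodal (t u : nat) : (k + t + u < #|T|)%N ->
  (#|small_cubes t| + #|small_cubes u| <= 2 ^ #|T|)%N.
Proof.
move=> ltT; rewrite -cardsT; apply: antipodal_bound;
  rewrite ?powersetT ?finset.subsetT //.
move=> A /small_cubesP[i lei iA]; apply/small_cubesP => -[j lej jA].
have := symdiff_cube iA jA.
rewrite (_ : symdiff _ _ = [set: T]%SET) ?cardsT; first by lia.
by apply/finset.setP=> z; rewrite !inE; case: (z \in A).
Qed.

Local Open Scope ring_scope.
Variable R : realFieldType.

Lemma geometric_half (s D : nat) : (s <= D)%N ->
  \sum_(s <= j < D) (1 / 2 ^+ j.+1) = 1 / 2 ^+ s - 1 / 2 ^+ D :> R.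
Proof.
elim: D => [|D IHD].
  by rewrite leqn0 => /eqP ->; rewrite big_geq // subrr.
rewrite leq_eqVlt => /orP[/eqP ->|]; first by rewrite big_geq // subrr.
rewrite ltnS => lesD; rewrite big_nat_recr //= IHD // !exprS; field.
by rewrite ?expf_neq0 ?pnatr_eq0.
Qed.

(** A word with [s <= D] stars receives [1 - 2^s / 2^D] from the sum and [2^s / 2^D] from the last
    term, exactly 1 in total; for [s > D] the last term alone exceeds 1. *)
Lemma card_codes_le (D : nat) :
  #|I|%:R <= \sum_(0 <= j < D) #|small_cubes j|%:R / 2 ^+ j.+1
             + 2 ^+ #|T| / 2 ^+ D :> R.
Proof.
have pow0 (n : nat) : 0 < 2 ^+ n :> R by rewrite exprn_gt0.
(* No word has more than [#|T|] stars, so at level [#|T|] all the disjoint cubes are counted inside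
   the full cube. *)
have tot : \sum_i 2 ^+ #|stars i| <= 2 ^+ #|T| :> R.
  have := card_small_cubes #|T|.
  rewrite (eq_bigl predT) => [eqS|i]; last by rewrite max_card.
  have : (#|small_cubes #|T| | <= 2 ^ #|T|)%N.
    by rewrite -cardsT -card_powerset powersetT subset_leq_card ?finset.subsetT.
  rewrite eqS -(ler_nat R) natr_sum natrX.
  by under eq_bigr do rewrite natrX.
have -> : #|I|%:R = \sum_(i : I) (1 : R) by rewrite sumr_const.
apply: le_trans (_ : _ <= \sum_(i : I) (\sum_(0 <= j < D | (#|stars i| <= j)%N)
   2 ^+ #|stars i| / 2 ^+ j.+1 + 2 ^+ #|stars i| / 2 ^+ D)) _.
  apply: ler_sum => i _.
  have [leD|ltD] := leqP #|stars i| D.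
    rewrite (eq_bigl (fun j => true && (#|stars i| <= j)%N)) //.
    rewrite -big_nat_widenl //.
    under eq_bigr do rewrite -[X in X / _]mulr1 -mulrA.
    rewrite -mulr_sumr geometric_half // mulrBr !mulrA mulr1.
    by rewrite divff ?subrK // gt_eqF.
  rewrite ler_wpDl //.
    by apply: sumr_ge0 => j _; rewrite divr_ge0 // ltW.
  by rewrite ler_pdivlMr // mul1r ler_eXn2l ?ltr1n // ltnW.
rewrite big_split /= -mulr_suml lerD //; last first.
  by rewrite ler_wpM2r // invr_ge0 ltW.
rewrite (exchange_big_dep predT) //=; apply: ler_sum => j _.
rewrite -mulr_suml card_small_cubes natr_sum.
by under [X in _ <= X / _]eq_bigr do rewrite natrX.
Qed.

End Codes.

Local Open Scope ring_scope.

(** Each induction step takes the outermost remaining terms, [m] and [D - m - 1], and replaces the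
    second by [c - S m]. The freed [c / 2 ^+ (D - m)] doubles the last term. *)
Lemma pair_terms (R : realFieldType) (S : nat -> R) (c : R) (D m : nat) :
  (m.*2 <= D)%N -> (forall j, (j < m)%N -> S j + S (D - j.+1)%N <= c) ->
  \sum_(0 <= j < D) S j / 2 ^+ j.+1 + c / 2 ^+ D <=
  \sum_(0 <= j < m) (1 / 2 ^+ j.+1 - 1 / 2 ^+ (D - j)) * S j
  + \sum_(m <= j < D - m) S j / 2 ^+ j.+1 + c / 2 ^+ (D - m).
Proof.
elim: m => [|m IHm] le2m leS.
  by rewrite subn0 [\sum_(0 <= j < 0) _]big_geq // add0r.
apply: le_trans (IHm _ _) _; [by lia | by move=> j ltj; apply: leS; lia |].
rewrite big_nat_recr //= (big_ltn (m := m) (n := (D - m)%N)); last by lia.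
have -> : (D - m = (D - m.+1).+1)%N by lia.
rewrite [\sum_(m.+1 <= j < (D - m.+1).+1) _]big_nat_recr; last by lia.
have := leS m (ltnSn m); set a := S m; set b := S (D - m.+1)%N => leab /=.
set X := \sum_(0 <= j < m) _; set Y := \sum_(m.+1 <= j < _) _.
have -> : (D - m.+1).+1 = (D - m)%N by lia.
(* The gap between the two sides is [(c - (a + b)) / 2 ^+ (D - m)]. *)
rewrite -subr_ge0.
have -> : c / 2 ^+ (D - m.+1) = 2 * (c / 2 ^+ (D - m)).
  have -> : (D - m = (D - m.+1).+1)%N by lia.
  by rewrite exprS; field; rewrite ?expf_neq0 ?pnatr_eq0.
rewrite (_ : _ - _ = (c - (a + b)) / 2 ^+ (D - m)); last by ring.
by rewrite divr_ge0 ?exprn_ge0 // subr_ge0.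
Qed.

(** The middle terms stay explicit, as the choice of [m] decides how many remain unpaired. *)
Lemma card_codes_Bconf (T I : finType) (P N : I -> {set T}) (k m : nat)
    (R : realFieldType) :
  (forall i, P i :&: N i = finset.set0) ->
  (forall i j, i != j -> 0 < #|clash P N i j| <= k)%N ->
  (0 < k < #|T|)%N -> (m.*2 <= #|T| - k)%N ->
  #|I|%:R <= \sum_(0 <= j < m) (1 / 2 ^+ j.+1 - 1 / 2 ^+ (#|T| - k - j))
                               * #|Bconf #|T| (k + 2 * j)|%:R
             + \sum_(m <= j < #|T| - k - m) #|small_cubes P N j|%:R / 2 ^+ j.+1
             + 2 ^+ (k + m) :> R.
Proof.
move=> PN0 clashP /andP[k_gt0 ltkT] le2m.
have clash_gt0 i j : i != j -> (0 < #|clash P N i j|)%N.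
  by move=> /clashP/andP[].
have clash_le i j : i != j -> (#|clash P N i j| <= k)%N.
  by move=> /clashP/andP[].
apply: le_trans (card_codes_le PN0 clash_gt0 R (#|T| - k)) _.
have anti (j : nat) : (j < m)%N ->
    #|small_cubes P N j|%:R + #|small_cubes P N (#|T| - k - j.+1)|%:R
    <= 2 ^+ #|T| :> R.
  move=> ltjm; rewrite -natrD -natrX ler_nat.
  by apply: (small_cubes_antipodal PN0 clash_le); lia.
apply: le_trans (pair_terms le2m anti) _.
have -> : 2 ^+ #|T| / 2 ^+ (#|T| - k - m) = 2 ^+ (k + m) :> R.
  rewrite -expfB_cond ?pnatr_eq0 //; last by lia.
  by congr (_ ^+ _); lia.
rewrite !lerD2r big_nat_cond [leRHS]big_nat_cond; apply: ler_sum => j.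
rewrite andbT => /= ltjm; rewrite card_Bconf ?(leq_trans _ ltkT) //.
(* Kleitman's bound may be inserted because the coefficient is nonnegative: [j < m] and
   [m.*2 <= #|T| - k] give [j + 1 <= #|T| - k - j]. *)
apply: ler_wpM2l.
  rewrite subr_ge0 !mul1r lef_pV2 ?posrE ?exprn_gt0 // ler_eXn2l ?ltr1n //.
  by move: le2m ltkT ltjm; clear; move: #|T| => n; lia.
rewrite ler_nat; apply: (small_cubes_kleitman PN0 clash_le).
by lia.
Qed.

(** * From boxes to words *)

Section Geometry.
Variables (R : realType) (d : nat).
Implicit Types (lo hi : 'I_d -> R) (S : set 'rV[R]_d).

Definition box lo hi : set 'rV[R]_d :=
  [set x | forall i, lo i <= x 0 i <= hi i]%classic.

Lemma standard_boxP S : standard_box S ->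
  exists lohi : ('I_d -> R) * ('I_d -> R), S = box lohi.1 lohi.2.
Proof.
move=> [K [Kitv ->]].
have /choice[f fP] (i : 'I_d) : exists ab : R * R, K i = `[ab.1, ab.2]%classic.
  by have [a [b [_ ->]]] := Kitv i; exists (a, b).
exists (fun i => (f i).1, fun i => (f i).2); apply/seteqP; split=> x /= xK i;
  by have := xK i; rewrite fP /= in_itv.
Qed.

Lemma has_dim_nonempty S n : has_dim S n -> exists x, S x.
Proof.
move=> [x0 [V [hullS _]]].
have : flat x0 V x0 by rewrite /flat /= subrr sub0mx.
rewrite -hullS => -[[|p] [c [x [xS c1 _]]]].
  by move: c1; rewrite big_ord0 => /esym/eqP; rewrite oner_eq0.
by exists (x ord0).
Qed.

Lemma affine_hull_sub S x : S x -> affine_hull S x.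
Proof.
move=> Sx; exists 1%N, (fun=> 1), (fun=> x); split=> //.
  by rewrite big_ord1.
by rewrite big_ord1 scale1r.
Qed.

Lemma affine_hull_coord S y i (a : R) :
  (forall x, S x -> x 0 i = a) -> affine_hull S y -> y 0 i = a.
Proof.
move=> Sa [n [c [x [xS c1 ->]]]]; rewrite summxE.
rewrite (eq_bigr (fun j => c j * a)) => [|j _]; last by rewrite mxE Sa.
by rewrite -mulr_suml c1 mul1r.
Qed.

(** The direction of the affine hull is spanned by the unit vectors along the nondegenerate sides,
    which are the rows of [M]. *)
Lemma has_dim_box lo hi n : has_dim (box lo hi) n ->
  n = #|[set i | lo i < hi i]%SET|.
Proof.
move=> dimS; have [z zS] := has_dim_nonempty dimS.
have lohi i : lo i <= hi i by have /andP[] := zS i; apply: le_trans.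
have [x0 [V [hullS <-]]] := dimS.
set J := [set i | lo i < hi i]%SET.
pose M : 'M[R]_(#|J|, d) := \matrix_(l, j) (enum_val l == j)%:R.
have rowM l : row l M = delta_mx 0 (enum_val l) :> 'rV[R]_d.
  by apply/rowP=> j; rewrite !mxE eqxx eq_sym.
have deltaM i : i \in J -> ((delta_mx 0 i : 'rV[R]_d) <= M)%MS.
  move=> iJ; have := row_sub (enum_rank_in iJ i) M.
  by rewrite rowM (enum_rankK_in iJ iJ).
have rankM : \rank M = #|J|.
  apply/eqP; rewrite eqn_leq rank_leq_row -[X in (X <= _)%N](mxrank1 R).
  have <- : M *m M^T = 1%:M.
    apply/matrixP=> l l'; rewrite !mxE (bigD1 (enum_val l)) //= big1 => [|j].
      by rewrite !mxE eqxx mul1r addr0 eq_sym (inj_eq enum_val_inj).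
    by rewrite !mxE eq_sym => /negbTE ->; rewrite mul0r.
  exact: mxrankM_maxl.
rewrite -rankM; apply/eqP; rewrite eqn_leq; apply/andP; split; apply: mxrankS;
    apply/row_subP=> l.
  rewrite [row l V]row_sum_delta; apply: summx_sub => j _.
  have [jJ|jJ] := boolP (j \in J); first exact: scalemx_sub (deltaM j jJ).
  (* In a degenerate direction the coordinate is constant on the hull, so every row of [V] vanishes
     there. *)
  have hull_j y : affine_hull (box lo hi) y -> y 0 j = lo j.
    apply: affine_hull_coord => x /(_ j); move: jJ; rewrite inE -leNgt => hl.
    by case/andP=> lx xh; apply/eqP; rewrite eq_le lx (le_trans xh).
  have := hull_j (x0 + row l V); have := hull_j x0; rewrite hullS.
  rewrite /flat /= subrr sub0mx => /(_ isT) x0j.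
  rewrite [x0 + _]addrC addrK row_sub => /(_ isT) /eqP.
  rewrite mxE x0j -subr_eq0 addrK => /eqP ->.
  by rewrite scale0r sub0mx.
rewrite rowM; set i := enum_val l.
have iJ : lo i < hi i by have := enum_valP l; rewrite inE.
(* [p] is the lowest corner and [q + p] its neighbour along side [i]; their difference puts the
   [i]-th unit vector in the direction space. *)
pose p : 'rV[R]_d := \row_j lo j.
pose q : 'rV[R]_d := (hi i - lo i) *: delta_mx 0 i.
have pS : box lo hi p by move=> j; rewrite mxE lexx lohi.
have qS : box lo hi (q + p).
  move=> j; rewrite !mxE eqxx /=; case: eqVneq => [->|_].
    by rewrite mulr1 subrK lexx lohi.
  by rewrite mulr0 add0r lexx lohi.
have := affine_hull_sub pS; have := affine_hull_sub qS; rewrite hullS.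
rewrite /flat /= -addrA => qV pV.
have {qV} : (q <= V)%MS by rewrite -(addrK (p - x0) q) addmx_sub // eqmx_opp.
by rewrite eqmx_scale // subr_eq0 gt_eqF.
Qed.

Lemma box_setI lo hi lo' hi' : (box lo hi `&` box lo' hi')%classic =
  box (fun i => Num.max (lo i) (lo' i)) (fun i => Num.min (hi i) (hi' i)).
Proof.
apply/seteqP; split=> x /=.
  by move=> [xS xS'] i; rewrite ge_max le_min -andbACA xS xS'.
move=> xS; split=> i; have := xS i; rewrite ge_max le_min -andbACA;
  by case/andP.
Qed.

(** The largest left endpoint serves as the common point. *)
Lemma helly (I : finType) (a b : I -> R) :
  (forall i j, a i <= b j) -> exists c, forall i, a i <= c <= b i.
Proof.
move=> ab; have [i0 _|I0] := pickP (@predT I); last first.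
  by exists 0 => i; have := I0 i.
exists (a [arg max_(i > i0) a i]%O) => i; case: arg_maxP => // j _ maxj.
by rewrite ab andbT; apply: maxj.
Qed.

Lemma neighborly_boxes_codes (k : nat) (F : {fset set 'rV[R]_d}) :
  (0 < d)%N -> (k < d)%N -> neighborly_boxes k F ->
  exists P N : F -> {set 'I_d},
    (forall A, P A :&: N A = finset.set0) /\
    (forall A B, A != B -> 0 < #|clash P N A B| <= k)%N.
Proof.
move=> d_gt0 ltkd [boxF dimF].
have /choice[f fP] (A : F) :
    exists lohi : ('I_d -> R) * ('I_d -> R), val A = box lohi.1 lohi.2.
  by apply: standard_boxP; have [] := boxF _ (valP A).
pose a i A := (f A).1 i; pose b i A := (f A).2 i.
(* Full dimension makes all [d] sides nondegenerate. *)
have ab i A : a i A < b i A.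
  have [_] := boxF _ (valP A); rewrite fP => /has_dim_box cardJ.
  have /setP : [set i | (f A).1 i < (f A).2 i]%SET = [set: 'I_d]%SET.
    by apply/eqP; rewrite eqEcard finset.subsetT cardsT card_ord -cardJ leqnn.
  by move/(_ i); rewrite !inE.
pose J A B := [set i | Num.max (a i A) (a i B) < Num.min (b i A) (b i B)]%SET.
have cross A B : A != B ->
    (forall i, a i A <= b i B) /\ (d - k <= #|J A B| <= d - 1)%N.
  move=> neAB; have neAB' : val A <> val B.
    by apply/eqP; rewrite (inj_eq val_inj).
  have [n [len]] := dimF _ _ (valP A) (valP B) neAB'.
  rewrite !fP box_setI => dimI.
  have := has_dim_box dimI; rewrite -/(J A B) => <-.
  split=> // i; have [x /(_ i)] := has_dim_nonempty dimI.
  rewrite ge_max le_min => /andP[/andP[ax _] /andP[_ xb]].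
  exact: le_trans ax xb.
have /choice[c cP] (i : 'I_d) : exists c, forall A, a i A <= c <= b i A.
  apply: helly => A B; have [->|/cross[]//] := eqVneq A B; exact: ltW.
(* The word has 1 where the box starts at [c i], 0 where it ends there, and a star otherwise. *)
exists (fun A => [set i | a i A == c i]%SET),
       (fun A => [set i | b i A == c i]%SET).
split=> [A|A B /cross[_ Jd]].
  apply/finset.setP=> i; rewrite !inE; apply/negP=> /andP[/eqP ac /eqP bc].
  by have := ab i A; rewrite ac bc ltxx.
set X := clash _ _ _ _; suff XJ : X = ~: J A B.
  have := cardsC (J A B); rewrite -XJ card_ord.
  by move: Jd; move: #|J A B| #|X| => u v; clear -ltkd; lia.
apply/finset.setP=> i; rewrite !inE lt_min !gt_max.
have := (cP i A, cP i B); have := (ab i A, ab i B).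
move=> [abA abB] [/andP[aA bA] /andP[aB bB]].
rewrite abA abB andbT /= negb_and -!leNgt.
(* With both sides nondegenerate, the intersection is degenerate only if one interval ends no later
   than the other starts; [c i] lies between, which forces both endpoints to equal it. *)
have eq_pinch (x y z : R) : x <= z -> z <= y -> (y <= x) = (x == z) && (y == z).
  move=> xz zy; apply/idP/andP => [yx|[/eqP -> /eqP ->]//].
  by split; rewrite eq_le ?xz ?zy ?(le_trans zy yx) ?(le_trans yx xz).
rewrite (eq_pinch _ _ (c i)) // (eq_pinch _ _ (c i)) //.
by rewrite orbC [_ && (a i B == _)]andbC.
Qed.

End Geometry.

Theorem theorem1p4 (R : realType) (d k : nat)
    (hk : (1 <= k)%N) (hkd : (k <= d - 1)%N) :
  (~~ odd (d - k) ->
     (max_neighborly R k d <=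
       (\sum_(0 <= j < (d - k - 2)./2.+1)
           (1 / 2 ^+ j.+1 - 1 / 2 ^+ (d - k - j)) * #|Bconf d (k + 2 * j)|%:R
        + 2 ^+ ((d + k)./2))%:E)%E) /\
  (odd (d - k) ->
     (max_neighborly R k d <=
       (\sum_(0 <= j < (d - k - 1)./2)
           (1 / 2 ^+ j.+1 - 1 / 2 ^+ (d - k - j)) * #|Bconf d (k + 2 * j)|%:R
        + 1 / 2 ^+ ((d - k + 1)./2) * #|Bconf d (d - 1)|%:R
        + 2 ^+ ((d + k - 1)./2))%:E)%E).
Proof.
(* [S] abstracts the numbers S_j, keeping only Kleitman's bound, so each parity reduces to choosing
   [m] and a numerical check. *)
have bound m (rhs : R) : (m.*2 <= d - k)%N ->
    (forall S : nat -> R,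
       (forall j, (k + 2 * j < d)%N -> S j <= #|Bconf d (k + 2 * j)|%:R) ->
       \sum_(0 <= j < m) (1 / 2 ^+ j.+1 - 1 / 2 ^+ (d - k - j))
                               * #|Bconf d (k + 2 * j)|%:R
             + \sum_(m <= j < d - k - m) S j / 2 ^+ j.+1
             + 2 ^+ (k + m) <= rhs) ->
    (max_neighborly R k d <= rhs%:E)%E.
  move=> le2m rhsP; apply: ge_ereal_sup => _ [F nF <-]; rewrite lee_fin cardfE.
  have [||P [N [PN0 clashP]]] := neighborly_boxes_codes _ _ nF; try lia.
  have := card_codes_Bconf R PN0 clashP (m := m); rewrite card_ord.
  move=> /(_ ltac:(lia) le2m) /le_trans; apply.
  apply: rhsP => j ltj.
  have clash_le i i' : i != i' -> (#|clash P N i i'| <= k)%N.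
    by move=> /clashP/andP[].
  have := small_cubes_kleitman PN0 clash_le (t := j).
  rewrite card_ord => /(_ ltj).
  by rewrite card_Bconf ?ler_nat //; lia.
split=> parity.
  (* With [m = (d - k) / 2] every term is paired and the middle sum is empty. Evenness and [k < d]
     give [2 <= d - k], so the subtraction in the upper limit does not truncate. *)
  have eqD := even_halfK parity; set m := (d - k)./2 in eqD.
  apply: (bound m) => [|S _]; first by lia.
  rewrite (_ : (d - k - m = m)%N); last by lia.
  rewrite (big_geq (m := m)) // addr0.
  have -> : ((d - k - 2)./2.+1 = m)%N by lia.
  by have -> : ((d + k)./2 = k + m)%N by lia.
(* Here [d - k = 2m + 1], so the single term [j = m] stays unpaired; as [k + 2 * m = d - 1],
   Kleitman's theorem still just applies and yields the term in B_(d-1). *)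
have eqD := odd_halfK parity; set m := (d - k)./2 in eqD.
apply: (bound m) => [|S SB]; first by lia.
rewrite (_ : (d - k - m = m.+1)%N); last by lia.
rewrite big_nat1.
have -> : ((d - k - 1)./2 = m)%N by lia.
have -> : ((d + k - 1)./2 = k + m)%N by lia.
have -> : ((d - k + 1)./2 = m.+1)%N by lia.
rewrite lerD2r lerD2l mul1r mulrC ler_wpM2l ?invr_ge0 ?exprn_ge0 //.
have -> : (d - 1 = k + 2 * m)%N by lia.
by apply: SB; lia.
Qed.
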